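(* Let $A\in\mathbb{S}^n$, let $\mathcal{X}$ be a set of unordered pairs of distinct elements of $\{1,\dots,n\}$, and let $r\in\{1,\dots,n\}$. Let $\mathcal{X}^c$ be the set of unordered pairs of distinct elements of $\{1,\dots,n\}$ not in $\mathcal{X}$, let $m:=|\mathcal{X}^c|$, let $K\in\{0,1\}^{n\times m}$ be the node-edge incidence matrix of $\mathcal{X}^c$, let $\overline{K}\in\{-1,0,1\}^{n\times m}$ be the node-arc incidence matrix of $\mathcal{X}^c$ after assigning an arbitrary orientation to its edges, and let $$B:=\begin{bmatrix} 0 & 0 & K^{\top} \\ 0 & 0 & \overline{K}^{\top} \\ K & \overline{K} & A \end{bmatrix}\in\mathbb{S}^{2m+n}.$$ Then (i) there exists $R\in\mathbb{S}^n$ such that $R$ fits $\mathcal{X}$, $A+R\succeq 0$, and $\operatorname{rank}(A+R)\le r$, if and only if (ii) there exists $[\mathbf{u};\mathbf{v};\mathbf{d}]\in\mathbb{R}^m\times\mathbb{R}^m\times\mathbb{R}^n$ such that $B+\operatorname{Diag}([\mathbf{u};\mathbf{v};\mathbf{d}])\succeq 0$ and $\operatorname{rank}(B+\operatorname{Diag}([\mathbf{u};\mathbf{v};\mathbf{d}]))\le 2m+r$.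
   Context: $\mathbb{S}^n$ is the space of real symmetric $n\times n$ matrices; $\succeq 0$ means positive semidefinite; $\operatorname{Diag}(\mathbf{x})$ is the diagonal matrix with diagonal $\mathbf{x}$. $R$ fits $\mathcal{X}$ means $R_{ij}=0$ for all $\{i,j\}\in\mathcal{X}$ (diagonal entries unrestricted). The node-edge incidence matrix has one row per index in $\{1,\dots,n\}$ and one column per pair $\{i,j\}\in\mathcal{X}^c$, with exactly two ones in that column, in rows $i$ and $j$; in the node-arc incidence matrix the column of the pair has a $1$ and a $-1$ in these two rows, according to the orientation. *)

(* Defs.v *)
From HB Require Import structures.
From mathcomp Require Import all_boot all_order all_algebra.
From mathcomp Require Import reals.

Set Implicit Arguments.
Unset Strict Implicit.
Unset Printing Implicit Defensive.

Import Order.TTheory GRing.Theory Num.Theory.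
Local Open Scope ring_scope.

Definition psd (R : realType) (n : nat) (M : 'M[R]_n) : Prop :=
  M \is symmetricmx /\ forall x : 'cV[R]_n, 0 <= (x^T *m M *m x) 0 0.

(* Unordered pairs of distinct indices are encoded as two-element sets. *)
Definition pair_set (n : nat) (X : {set {set 'I_n}}) : Prop :=
  forall e, e \in X -> #|e| = 2%N.

Definition fits (R : realType) (n : nat) (X : {set {set 'I_n}})
    (M : 'M[R]_n) : Prop :=
  forall i j : 'I_n, [set i; j] \in X -> M i j = 0.

Definition pair_compl (n : nat) (X : {set {set 'I_n}}) : {set {set 'I_n}} :=
  [set e : {set 'I_n} | (#|e| == 2%N) && (e \notin X)].

(* Columns are indexed by 'I_#|E|, the k-th one being that of [enum_val k]. *)
Definition node_edge (R : realType) (n : nat) (E : {set {set 'I_n}}) :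
    'M[R]_(n, #|E|) :=
  \matrix_(i < n, k < #|E|) (i \in (enum_val k : {set 'I_n}))%:R.

(* [o] orders the endpoints of each edge; the first one gets the entry 1 and
   the second one the entry -1 in the node-arc incidence matrix. *)
Definition orientation (n : nat) (E : {set {set 'I_n}})
    (o : {set 'I_n} -> 'I_n * 'I_n) : Prop :=
  forall e, e \in E -> e = [set (o e).1; (o e).2].

Definition node_arc (R : realType) (n : nat) (E : {set {set 'I_n}})
    (o : {set 'I_n} -> 'I_n * 'I_n) : 'M[R]_(n, #|E|) :=
  \matrix_(i < n, k < #|E|)
    ((i == (o (enum_val k)).1)%:R - (i == (o (enum_val k)).2)%:R).

Definition bordered (R : realType) (n m : nat) (K L : 'M[R]_(n, m))
    (A : 'M[R]_n) : 'M[R]_(m + m + n) :=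
  block_mx (0 : 'M[R]_(m + m)) (col_mx K^T L^T) (row_mx K L) A.

(* Main.v *)
Require Import Defs.
From HB Require Import structures.
From mathcomp Require Import all_boot all_order all_algebra.
From mathcomp Require Import reals.
From mathcomp Require Import ring lra.

Set Implicit Arguments.
Unset Strict Implicit.
Unset Printing Implicit Defensive.

Import Order.TTheory GRing.Theory Num.Theory.
Local Open Scope ring_scope.

(** The theorem is a Schur complement computation. When [u] and [v] have
    positive entries, eliminating the first [2m] rows and columns of
    [B + Diag [u; v; d]] is a congruence that leaves

      [A + Diag d - G],  where  [G = K Diag(1/u) K^T + L Diag(1/v) L^T];

    it preserves semidefiniteness and lowers the rank by exactly [2m]
    ([bordered_psd_rank]). So the shifted bordered matrix stands for some [A + S] with
    [S = Diag d - G], and it remains to see which [S] arise.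

    Off the diagonal, [G] vanishes at every pair that is not an edge, and equals
    [1/u_k - 1/v_k] at the [k]-th edge ([weighted_incidence_non_edge],
    [weighted_incidence_edge]). Hence [S] always fits [X]. Conversely any
    symmetric [S] that fits [X] arises: every real number is a difference of two
    positive ones, which gives [u] and [v], and [d] is then chosen to adjust
    the diagonal.

    Positivity of [u] and [v] is no loss: no column of [K] or [L] is
    zero, so semidefiniteness forces it ([bordered_psd_gt0]). *)

(** * Positive semidefinite matrices and Schur complements *)

Lemma symmetricmxP (F : fieldType) (n : nat) (M : 'M[F]_n) :
  reflect (M^T = M) (M \is symmetricmx).
Proof.
rewrite qualifE /= expr0 scale1r map_mx_id //.
by apply: (iffP eqP) => [{2}-> //|->].
Qed.

Lemma psd_congruence (R : realType) (p q : nat) (P : 'M[R]_(q, p))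
    (M : 'M[R]_p) :
  psd M -> psd (P *m M *m P^T).
Proof.
case=> /symmetricmxP sM pM; split.
  by apply/symmetricmxP; rewrite !trmx_mul trmxK sM mulmxA.
move=> x; have := pM (P^T *m x).
by rewrite trmx_mul trmxK !mulmxA.
Qed.

Lemma psd_congruence_unit (R : realType) (p : nat) (P M : 'M[R]_p) :
  P \in unitmx -> psd (P *m M *m P^T) <-> psd M.
Proof.
move=> uP; split; last exact: psd_congruence.
move=> /(psd_congruence (invmx P)).
rewrite !mulmxA mulVmx // mul1mx -mulmxA -trmx_mul mulVmx //.
by rewrite trmx1 mulmx1.
Qed.

Lemma psd_block_diag (R : realType) (p q : nat) (W : 'M[R]_p) (S : 'M[R]_q) :
  psd (block_mx W 0 0 S) <-> psd W /\ psd S.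
Proof.
split=> [h|[[/symmetricmxP sW pW] [/symmetricmxP sS pS]]].
  split.
    have := psd_congruence (row_mx 1%:M 0) h.
    rewrite tr_row_mx mul_row_block mul_row_col trmx1 trmx0.
    by rewrite !(mul1mx, mul0mx, mulmx1, mulmx0, addr0).
  have := psd_congruence (row_mx 0 1%:M) h.
  rewrite tr_row_mx mul_row_block mul_row_col trmx1 trmx0.
  by rewrite !(mul1mx, mul0mx, mulmx1, mulmx0, add0r).
split; first by apply/symmetricmxP; rewrite tr_block_mx !trmx0 sW sS.
move=> x; rewrite -[x]vsubmxK tr_col_mx mul_row_block mul_row_col.
by rewrite !mulmx0 addr0 add0r mxE addr_ge0.
Qed.

Lemma psd_diag (R : realType) (p : nat) (w : 'rV[R]_p) :
  (forall k, 0 <= w 0 k) -> psd (diag_mx w).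
Proof.
move=> hw; split; first by apply/symmetricmxP; rewrite tr_diag_mx.
move=> x; rewrite mul_mx_diag mxE sumr_ge0 // => k _.
by rewrite !mxE mulrAC mulr_ge0 // -expr2 sqr_ge0.
Qed.

Lemma quad_delta (R : realType) (p : nat) (M : 'M[R]_p) (i j : 'I_p) :
  ((delta_mx i 0 : 'cV_p)^T *m M *m (delta_mx j 0 : 'cV_p)) 0 0 = M i j.
Proof. by rewrite trmx_delta -rowE -colE !mxE. Qed.

Lemma psd_diag_gt0 (R : realType) (p : nat) (M : 'M[R]_p) (i j : 'I_p) :
  psd M -> M i j != 0 -> 0 < M i i.
Proof.
case=> /symmetricmxP sM pM Mij.
have Mji : M j i = M i j by rewrite -[in LHS]sM mxE.
rewrite lt0r; apply/andP; split; last by rewrite -quad_delta.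
apply/eqP => Mii.
(* The quadratic form at [t e_i + e_j] is affine in [t] once [M i i = 0]; this
   [t] is where it takes the value -1. *)
pose t := - (M j j + 1) / (2 * M i j).
have := pM (t *: delta_mx i 0 + delta_mx j 0).
rewrite [(_ + _)^T]raddfD /= [(_ *: _)^T]linearZ /= !mulmxDl !mulmxDr.
rewrite -!scalemxAl -!scalemxAr.
have addE (N N' : 'M[R]_1) : (N + N') 0 0 = N 0 0 + N' 0 0 by rewrite mxE.
have scaleE a (N : 'M[R]_1) : (a *: N) 0 0 = a * N 0 0 by rewrite mxE.
rewrite !(addE, scaleE) !quad_delta Mii Mji.
have -> : t * (t * 0) + t * M i j + (t * M i j + M j j) = -1 :> R.
  have tM : t * M i j = - (M j j + 1) / 2 by rewrite /t; field.
  by rewrite tM; lra.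
by rewrite ler0N1.
Qed.

(** Block Gaussian elimination, in the symmetric form that congruence needs:
    eliminating with the pivot [W], whose inverse is [V], leaves the Schur
    complement. *)
Lemma block_mx_schur (F : fieldType) (p q : nat) (W V : 'M[F]_p)
    (E : 'M[F]_(q, p)) (C : 'M[F]_q) :
  W *m V = 1%:M -> W^T = W -> V^T = V ->
  let P := block_mx 1%:M 0 (E *m V) 1%:M in
  block_mx W E^T E C =
  P *m block_mx W 0 0 (C - E *m V *m E^T) *m P^T.
Proof.
move=> WV sW sV P; have VW := mulmx1C WV.
rewrite /P tr_block_mx !mulmx_block !trmx1 trmx0 trmx_mul sV.
rewrite !(mul1mx, mul0mx, mulmx1, mulmx0, addr0, add0r) -(mulmxA E V W) VW.
by rewrite mulmx1 !mulmxA WV mul1mx addrC subrK.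
Qed.

(** A positive pivot block of size [p] is invisible to semidefiniteness and
    counts for exactly [p] in the rank, because congruence by an invertible
    matrix preserves both. *)
Lemma schur_psd_rank (R : realType) (p q : nat) (w : 'rV[R]_p)
    (E : 'M[R]_(q, p)) (C : 'M[R]_q) :
  (forall k, 0 < w 0 k) ->
  let M := block_mx (diag_mx w) E^T E C in
  let S := C - E *m diag_mx (map_mx GRing.inv w) *m E^T in
  (psd M <-> psd S) /\ \rank M = (p + \rank S)%N.
Proof.
move=> hw M S.
have wV : diag_mx w *m diag_mx (map_mx GRing.inv w) = 1%:M.
  rewrite mul_diag_mx; apply/matrixP => i j; rewrite !mxE.
  by have [->|_] := eqVneq i j; rewrite ?mulr0 // mulfV // gt_eqF.
pose P : 'M[R]_(p + q) :=
  block_mx 1%:M 0 (E *m diag_mx (map_mx GRing.inv w)) 1%:M.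
have uP : P \in unitmx by rewrite unitmxE det_lblock !det1 mulr1 unitr1.
have eM : M = P *m block_mx (diag_mx w) 0 0 S *m P^T.
  by apply: block_mx_schur; rewrite ?tr_diag_mx.
have uw : diag_mx w \in unitmx by case/mulmx1_unit: wV.
split.
  rewrite eM psd_congruence_unit // psd_block_diag.
  split=> [[]//|pS]; split=> //; apply: psd_diag => k.
  exact: ltW.
rewrite eM mxrankMfree ?row_free_unit ?unitmx_tr //.
rewrite eqmxMfull ?row_full_unit // rank_diag_block_mx.
by rewrite mxrank_unit.
Qed.

(** * Eliminating the border *)

Lemma bordered_diag (R : realType) (n m : nat) (K L : 'M[R]_(n, m))
    (A : 'M[R]_n) (u v : 'rV[R]_m) (d : 'rV[R]_n) :
  bordered K L A + diag_mx (row_mx (row_mx u v) d) =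
  block_mx (diag_mx (row_mx u v)) (row_mx K L)^T (row_mx K L) (A + diag_mx d).
Proof.
by rewrite /bordered diag_mx_row add_block_mx tr_row_mx add0r !addr0.
Qed.

(** What the border removes from the bottom right block when it is eliminated,
    with [p] and [q] the inverses of the diagonal entries of the top left
    block. *)
Definition weighted_incidence (R : realType) (n m : nat)
    (K L : 'M[R]_(n, m)) (p q : 'rV[R]_m) : 'M[R]_n :=
  K *m diag_mx p *m K^T + L *m diag_mx q *m L^T.

Lemma bordered_psd_rank (R : realType) (n m : nat) (K L : 'M[R]_(n, m))
    (A : 'M[R]_n) (u v : 'rV[R]_m) (d : 'rV[R]_n) :
  (forall k, 0 < u 0 k) -> (forall k, 0 < v 0 k) ->
  let M := bordered K L A + diag_mx (row_mx (row_mx u v) d) in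
  let S := A + diag_mx d
    - weighted_incidence K L (map_mx GRing.inv u) (map_mx GRing.inv v) in
  (psd M <-> psd S) /\ \rank M = (2 * m + \rank S)%N.
Proof.
move=> hu hv M S.
have hw k : 0 < row_mx u v 0 k.
  by case: (split_ordP k) => k' ->; rewrite ?row_mxEl ?row_mxEr.
have := schur_psd_rank (row_mx K L) (A + diag_mx d) hw.
rewrite /M bordered_diag mul2n -addnn /=.
suff -> : row_mx K L *m diag_mx (map_mx GRing.inv (row_mx u v))
   *m (row_mx K L)^T =
   weighted_incidence K L (map_mx GRing.inv u) (map_mx GRing.inv v) by [].
rewrite map_row_mx diag_mx_row mul_row_block !mulmx0 addr0 add0r.
by rewrite tr_row_mx mul_row_col.
Qed.

Lemma tr_weighted_incidence (R : realType) (n m : nat) (K L : 'M[R]_(n, m))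
    (p q : 'rV[R]_m) :
  (weighted_incidence K L p q)^T = weighted_incidence K L p q.
Proof.
by rewrite /weighted_incidence linearD /= !trmx_mul !trmxK !tr_diag_mx !mulmxA.
Qed.

(** In a positive semidefinite matrix, a zero on the diagonal forces its whole
    row to vanish. A nonzero column of [K] or [L] therefore forces the
    corresponding entry of [u] or [v] to be positive, which is what makes the
    top left block invertible. *)
Lemma bordered_psd_gt0 (R : realType) (n m : nat) (K L : 'M[R]_(n, m))
    (A : 'M[R]_n) (u v : 'rV[R]_m) (d : 'rV[R]_n) :
  psd (bordered K L A + diag_mx (row_mx (row_mx u v) d)) ->
  (forall i k, K i k != 0 -> 0 < u 0 k) /\
  (forall i k, L i k != 0 -> 0 < v 0 k).
Proof.
rewrite bordered_diag diag_mx_row tr_row_mx => pM; split=> i k hik.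
  have := psd_diag_gt0 (i := lshift n (lshift m k)) (j := rshift (m + m) i) pM.
  rewrite block_mxEur col_mxEu !block_mxEul !mxE eqxx mulr1n.
  exact.
have := psd_diag_gt0 (i := lshift n (rshift m k)) (j := rshift (m + m) i) pM.
rewrite block_mxEur col_mxEd block_mxEul block_mxEdr !mxE eqxx mulr1n.
exact.
Qed.

(** * Incidence matrices of a set of pairs *)

Lemma orientation_neq (n : nat) (E : {set {set 'I_n}})
    (o : {set 'I_n} -> 'I_n * 'I_n) (e : {set 'I_n}) :
  pair_set E -> orientation E o -> e \in E -> (o e).1 != (o e).2.
Proof.
move=> hE ho eE; have := hE _ eE; rewrite [in #|_|](ho _ eE) cards2.
by case: eqVneq.
Qed.

Lemma node_edge_neq0 (R : realType) (n : nat) (E : {set {set 'I_n}})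
    (o : {set 'I_n} -> 'I_n * 'I_n) (k : 'I_#|E|) :
  orientation E o -> node_edge R E (o (enum_val k)).1 k != 0.
Proof.
move=> ho; rewrite mxE; have e := ho _ (enum_valP k).
suff -> : (o (enum_val k)).1 \in (enum_val k : {set 'I_n}) by rewrite oner_neq0.
by rewrite {2}e set21.
Qed.

Lemma node_arc_neq0 (R : realType) (n : nat) (E : {set {set 'I_n}})
    (o : {set 'I_n} -> 'I_n * 'I_n) (k : 'I_#|E|) :
  pair_set E -> orientation E o -> node_arc R E o (o (enum_val k)).1 k != 0.
Proof.
move=> hE ho; rewrite mxE eqxx.
by rewrite (negbTE (orientation_neq hE ho (enum_valP k))) subr0 oner_neq0.
Qed.

(** For distinct [i] and [j] to be both endpoints of an edge, that edge has to
    be [{i, j}]; the node-edge entries then multiply to 1, and the node-arc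
    entries to -1, whichever way the edge is oriented. *)
Lemma incidence_entry_prod (R : realType) (n : nat) (i j a b : 'I_n)
    (p q : R) :
  a != b -> i != j ->
  (i \in [set a; b])%:R * p * (j \in [set a; b])%:R
    + ((i == a)%:R - (i == b)%:R) * q * ((j == a)%:R - (j == b)%:R)
  = ([set a; b] == [set i; j])%:R * (p - q).
Proof.
move=> ab ij.
have -> : ([set a; b] == [set i; j]) =
          (i \in [set a; b]) && (j \in [set a; b]).
  rewrite eq_sym eqEcard !cards2 ab ij leqnn andbT.
  by rewrite subUset !sub1set.
rewrite !inE.
have [ia|] := eqVneq i a; have [ib|] := eqVneq i b;
have [ja|] := eqVneq j a; have [jb|] := eqVneq j b => //=; subst;
rewrite ?eqxx in ab ij * => //; lra.
Qed.

(** Each edge contributes to its own off-diagonal position alone, with two free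
    weights of opposite sign: this is why two incidence matrices, one signed
    and one not, are used. *)
Lemma weighted_incidence_offdiag (R : realType) (n : nat)
    (E : {set {set 'I_n}}) (o : {set 'I_n} -> 'I_n * 'I_n)
    (p q : 'rV[R]_#|E|) (i j : 'I_n) :
  pair_set E -> orientation E o -> i != j ->
  weighted_incidence (node_edge R E) (node_arc R E o) p q i j =
  \sum_k (enum_val k == [set i; j])%:R * (p 0 k - q 0 k).
Proof.
move=> hE ho ij; rewrite /weighted_incidence !mul_mx_diag !mxE -big_split /=.
apply: eq_bigr => k _; rewrite !mxE.
have ek := enum_valP k; rewrite {1 2}(ho _ ek) [in RHS](ho _ ek).
exact: incidence_entry_prod (orientation_neq hE ho ek) ij.
Qed.

Lemma weighted_incidence_non_edge (R : realType) (n : nat)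
    (E : {set {set 'I_n}}) (o : {set 'I_n} -> 'I_n * 'I_n)
    (p q : 'rV[R]_#|E|) (i j : 'I_n) :
  pair_set E -> orientation E o -> i != j -> [set i; j] \notin E ->
  weighted_incidence (node_edge R E) (node_arc R E o) p q i j = 0.
Proof.
move=> hE ho ij ijE; rewrite weighted_incidence_offdiag // big1 // => k _.
have [e|] := eqVneq; last by rewrite mul0r.
by rewrite -e enum_valP in ijE.
Qed.

Lemma weighted_incidence_edge (R : realType) (n : nat)
    (E : {set {set 'I_n}}) (o : {set 'I_n} -> 'I_n * 'I_n)
    (p q : 'rV[R]_#|E|) (i j : 'I_n) (k : 'I_#|E|) :
  pair_set E -> orientation E o -> i != j -> enum_val k = [set i; j] ->
  weighted_incidence (node_edge R E) (node_arc R E o) p q i j = p 0 k - q 0 k.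
Proof.
move=> hE ho ij ek; rewrite weighted_incidence_offdiag // (bigD1 k) //= big1.
  by rewrite ek eqxx mul1r addr0.
by move=> l lk; rewrite -ek (inj_eq enum_val_inj) (negbTE lk) mul0r.
Qed.

Lemma set2_eq (T : finType) (i j a b : T) :
  i != j -> [set i; j] = [set a; b] -> (a, b) = (i, j) \/ (a, b) = (j, i).
Proof.
move=> ij e; have : i \in [set a; b] by rewrite -e set21.
have : j \in [set a; b] by rewrite -e set22.
rewrite !inE => /orP[] /eqP ja /orP[] /eqP ib; subst; rewrite ?eqxx // in ij *.
  by right.
by left.
Qed.

Lemma pair_compl_pairs (n : nat) (X : {set {set 'I_n}}) :
  pair_set (pair_compl X).
Proof. by move=> e; rewrite inE => /andP[/eqP]. Qed.

(** * Completion by a diagonal shift of the bordered matrix *)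

Theorem theorem4p1 (R : realType) (n : nat) (A : 'M[R]_n)
    (hA : A \is symmetricmx) (X : {set {set 'I_n}}) (hX : pair_set X)
    (r : nat) (hr : (1 <= r <= n)%N)
    (o : {set 'I_n} -> 'I_n * 'I_n) (ho : orientation (pair_compl X) o) :
  let m := #|pair_compl X| in
  let K : 'M[R]_(n, m) := node_edge R (pair_compl X) in
  let L : 'M[R]_(n, m) := node_arc R (pair_compl X) o in
  let B : 'M[R]_(m + m + n) := bordered K L A in
  (exists S : 'M[R]_n,
      [/\ S \is symmetricmx, fits X S, psd (A + S) & (\rank (A + S)%R <= r)%N])
  <->
  (exists (u v : 'rV[R]_m) (d : 'rV[R]_n),
      psd (B + diag_mx (row_mx (row_mx u v) d))
      /\ (\rank (B + diag_mx (row_mx (row_mx u v) d))%R <= 2 * m + r)%N).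
Proof.
move=> m K L B; have hE := @pair_compl_pairs _ X; split.
- move=> [S [/symmetricmxP sS fS pS rS]].
  pose s (k : 'I_m) := S (o (enum_val k)).1 (o (enum_val k)).2.
  (* Weights [p] and [q] are positive with [p - q = - s], so that the off-diagonal
     part of [S] is cancelled by that of [G]; the term [`|s k| + 1] is there for
     positivity only. *)
  pose p : 'rV[R]_m := \row_k (`|s k| + 1).
  pose q : 'rV[R]_m := \row_k (s k + (`|s k| + 1)).
  have p_gt0 k : 0 < p 0 k by rewrite mxE ltr_wpDl.
  have q_gt0 k : 0 < q 0 k.
    by rewrite mxE; have := ler_norm (- s k); rewrite normrN; lra.
  pose G := weighted_incidence K L p q.
  pose u : 'rV[R]_m := map_mx GRing.inv p.
  pose v : 'rV[R]_m := map_mx GRing.inv q.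
  pose d : 'rV[R]_n := \row_i (S + G) i i.
  have dE : diag_mx d = S + G.
    apply/matrixP => i j; rewrite mxE mxE.
    have [->|ij] := eqVneq i j; first by rewrite mulr1n.
    rewrite mulr0n [RHS]mxE.
    have [ijX|ijX] := boolP ([set i; j] \in X).
      by rewrite fS // weighted_incidence_non_edge ?addr0 // inE ijX andbF.
    have ijE : [set i; j] \in pair_compl X by rewrite inE cards2 ij ijX.
    pose k := enum_rank_in ijE [set i; j].
    have ek : enum_val k = [set i; j] by rewrite enum_rankK_in.
    rewrite (weighted_incidence_edge _ _ hE ho ij ek) !mxE.
    suff -> : s k = S i j by ring.
    (* The orientation of the edge decides whether [s k] is [S i j] or [S j i]. *)
    have [] := set2_eq ij (ho _ ijE); rewrite /s ek.
      by case: (o _) => a b [-> ->].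
    by case: (o _) => a b [-> ->]; rewrite -[in LHS]sS mxE.
  have [] := bordered_psd_rank K L A (u := u) (v := v) d.
  + by move=> k; rewrite mxE invr_gt0.
  + by move=> k; rewrite mxE invr_gt0.
  have mapVK (w : 'rV[R]_m) : map_mx GRing.inv (map_mx GRing.inv w) = w.
    by apply/matrixP => i j; rewrite !mxE invrK.
  rewrite /u /v !mapVK dE addrA addrK => psdE rankE.
  exists u, v, d; split; first exact/psdE.
  by rewrite rankE leq_add2l.
- move=> [u [v [d [pM rM]]]].
  have u_gt0 k : 0 < u 0 k.
    exact: (bordered_psd_gt0 pM).1 _ _ (node_edge_neq0 R k ho).
  have v_gt0 k : 0 < v 0 k.
    exact: (bordered_psd_gt0 pM).2 _ _ (node_arc_neq0 R k hE ho).
  have [psdE rankE] := bordered_psd_rank K L A d u_gt0 v_gt0.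
  set G := weighted_incidence _ _ _ _ in psdE rankE.
  exists (diag_mx d - G); rewrite addrA; split.
  + apply/symmetricmxP; rewrite linearB /= tr_diag_mx.
    by rewrite tr_weighted_incidence.
  + move=> i j ijX; have ij : i != j.
      by have := hX _ ijX; rewrite cards2; case: eqVneq.
    rewrite mxE [_ i j]mxE (negbTE ij) mulr0n mxE.
    by rewrite weighted_incidence_non_edge ?subrr // inE ijX andbF.
  + exact/psdE.
  + by move: rM; rewrite rankE leq_add2l.
Qed.
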